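(* Let $m\geq 3$, $n\geq 1$, let $H\subseteq S_m$ be a fixing subgroup, and let $f:S_m^n\to S_m/H$ be an $H$-social aggregator satisfying IR: for every $i\in[n]$, $j\in[m]$, $x^{-i}\in S_m^{n-1}$ and $x_i,y_i\in S_m$ with $x_i^{-1}(j)=y_i^{-1}(j)$, the $j$-profiles of $f(x^{-i},x_i)$ and of $f(x^{-i},y_i)$ coincide (as multisets). Then either $f$ is constant, or there exist a voter $i\in[n]$ and $y\in S_m$ such that for every $x\in S_m^n$, $$f(x)=\{x_i\circ y\circ h:\ h\in H\}.$$
   Context: $S_m$ is the symmetric group on $[m]$; a ranking $x\in S_m$ uses the convention $x(\text{rank})=\text{name}$, so $x^{-1}(j)$ is the rank of alternative $j$. Profiles are $x=(x_1,\dots,x_n)\in S_m^n$; $(x^{-i},y_i)$ denotes $x$ with $x_i$ replaced by $y_i$. $\circ$ is ordinary composition $(u\circ v)(r)=u(v(r))$. A subgroup $H\subseteq S_m$ is fixing if there is a partition of the rank set $[m]$ into $k\geq 2$ nonempty blocks $B_1,\dots,B_k$ with $H=\{h\in S_m: h(B_l)=B_l\text{ for all }l\}$. For $y\in S_m$ its coset is $Hy:=\{y\circ h: h\in H\}$ (the rankings obtained from $y$ by permuting ranks inside each block), and $S_m/H$ is the set of these cosets; an $H$-social aggregator is a map $S_m^n\to S_m/H$. (E.g. $H$ trivial gives full rankings; $H$ the stabilizer of rank $1$ gives a single winner.) The $j$-profile of a coset $K$ is the multiset $K^{-1}(j)=\{z^{-1}(j): z\in K\}$. The paper writes the dictatorial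 form as ''$Hy\circ x_i$'', composing permutations left to right; this is the coset displayed in the claim. *)

(* Defs.v *)
From mathcomp Require Import all_boot all_fingroup.

Set Implicit Arguments.
Unset Strict Implicit.
Unset Printing Implicit Defensive.

Import GroupScope.

(* A ranking [x : 'S_m] maps a rank to the name of the alternative at that
   rank, so [x^-1 j] is the rank of alternative [j].  Ranks and names both
   range over ['I_m], i.e. they are numbered from 0.

   The product of permutations is applied left to right,
   [(u * v) r = v (u r)]; the composite u \circ v is therefore [v * u].  In
   particular {y \circ h | h in H} is the right coset [H :* y], and S_m / H is
   [rcosets H [set: 'S_m]]. *)

Definition profile (n m : nat) := {ffun 'I_n -> 'S_m}.

Definition replace (n m : nat) (x : profile n m) (i : 'I_n) (y : 'S_m) :
  profile n m := [ffun k => if k == i then y else x k].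

Definition fixing (m : nat) (H : {set 'S_m}) : Prop :=
  exists P : {set {set 'I_m}},
    [/\ partition P [set: 'I_m],
        2 <= #|P|
      & H = [set h : 'S_m | [forall B in P, h @: B == B]]].

Definition social_aggregator (n m : nat) (H : {set 'S_m})
    (f : profile n m -> {set 'S_m}) : Prop :=
  forall x : profile n m, f x \in rcosets H [set: 'S_m].

(* The multiset {z^-1 j | z in K}, as a sequence to be read up to [perm_eq]. *)
Definition jprofile (m : nat) (K : {set 'S_m}) (j : 'I_m) : seq 'I_m :=
  [seq (z^-1) j | z : 'S_m in K].

Definition IR (n m : nat) (f : profile n m -> {set 'S_m}) : Prop :=
  forall (i : 'I_n) (j : 'I_m) (x : profile n m) (yi : 'S_m),
    (x i)^-1 j = yi^-1 j ->
    perm_eq (jprofile (f x) j) (jprofile (f (replace x i yi)) j).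

(* Main.v *)
(* Record, for each alternative, the block containing its rank in [f x].  By IR
   this block depends only on the vector of ranks the voters give to that
   alternative, say through [g j : [m]^n -> blocks]; and since [f x] is a coset,
   every block is used a fixed number of times.  If a voter swaps [j] and [j'],
   nothing changes for the other alternatives, so the pair of blocks of [j] and
   [j'] is only permuted.  Hence if voter [i] is pivotal for [g j] at [v], then
   [g j'] at [w] is the same function of the [i]-th coordinate, as soon as
   [j' != j] and [w] differs from [v] in all other coordinates.  As [m >= 3],
   any two pairs [(j, v)] are linked by two such steps, so [i] is a dictator. *)
Require Import Defs.
From mathcomp Require Import all_boot all_fingroup.

Set Implicit Arguments.
Unset Strict Implicit.
Unset Printing Implicit Defensive.

Import GroupScope.

Definition upd (I : finType) (A : Type) (v : {ffun I -> A}) (i : I) (a : A) :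
  {ffun I -> A} := [ffun k => if k == i then a else v k].

Lemma upd_id (I : finType) (A : Type) (v : {ffun I -> A}) i : upd v i (v i) = v.
Proof. by apply/ffunP => k; rewrite ffunE; case: eqP => [->|]. Qed.

(** Here [v] and [w] stand for the rank vectors of [j] and [j'] in one profile, hence differ at
    every voter; the two updates express that voter [i] swaps [j] and [j']. *)
Definition exchange (I A : finType) (J T : eqType)
    (g : J -> {ffun I -> A} -> T) : Prop :=
  forall i j j' (v w : {ffun I -> A}), j != j' -> (forall k, v k != w k) ->
    g j v != g j (upd v i (w i)) -> g j' (upd w i (v i)) = g j v.

Lemma ex_neq2 (A : finType) (a b : A) :
  3 <= #|A| -> exists2 c, c != a & c != b.
Proof.
move=> A3; have: 0 < #|[set: A] :\ a :\ b|.
  have := cardsD1 a [set: A]; have := cardsD1 b ([set: A] :\ a).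
  rewrite cardsT => -> eqA; move: A3; rewrite eqA.
  by case: (a \in _); case: (b \in _) => //=; case: #|_|.
by case/card_gt0P => c; rewrite !inE => /and3P[cb ca _]; exists c.
Qed.

(** The exchange property applies to any [c] that has a partner [c'] with a different value. Each
    [b] has one: [a], or else [a']. *)
Lemma exchange_step (I A : finType) (J T : eqType) (g : J -> {ffun I -> A} -> T)
    i j j' (v w : {ffun I -> A}) a a' :
  exchange g -> j != j' -> (forall k, k != i -> v k != w k) ->
  g j (upd v i a) != g j (upd v i a') ->
  forall b, g j' (upd w i b) = g j (upd v i b).
Proof.
move=> gE jj' vw piv.
have eq_col c c' : g j (upd v i c) != g j (upd v i c') ->
    g j' (upd w i c) = g j (upd v i c).
  move=> ncc'; have cc' : c != c' by apply: contraNneq ncc' => ->.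
  have updK (u : {ffun I -> A}) d d' : upd (upd u i d) i d' = upd u i d'.
    by apply/ffunP => k; rewrite !ffunE; case: eqP.
  have vw' k : upd v i c k != upd w i c' k.
    by rewrite !ffunE; case: (eqVneq k i) => // ki; apply: vw.
  have := gE i j j' _ _ jj' vw'.
  by rewrite !updK !ffunE eqxx; apply.
move=> b; case: (eqVneq (g j (upd v i b)) (g j (upd v i a))) => [ba|nba].
  by apply: (eq_col b a'); rewrite ba.
exact: eq_col nba.
Qed.

Lemma exchange_dictator (I A : finType) (J : finType) (T : eqType)
    (g : J -> {ffun I -> A} -> T) i j v a a' :
  3 <= #|A| -> 3 <= #|J| -> exchange g ->
  g j (upd v i a) != g j (upd v i a') ->
  forall j' w b, g j' (upd w i b) = g j (upd v i b).
Proof.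
move=> A3 J3 gE piv j' w b.
have [l lj lj'] := ex_neq2 j j' J3.
have uP k : exists c, (c != v k) && (c != w k).
  by have [c c1 c2] := ex_neq2 (v k) (w k) A3; exists c; rewrite c1.
(* The vector [u] avoids both [v] and [w] at every coordinate, so the two steps go from [(j, v)] to
   [(l, u)] to [(j', w)]. *)
pose u := [ffun k => xchoose (uP k)].
have u_v k : v k != u k.
  by rewrite ffunE eq_sym; have /andP[] := xchooseP (uP k).
have u_w k : u k != w k by rewrite ffunE; have /andP[] := xchooseP (uP k).
have step1 : forall c, g l (upd u i c) = g j (upd v i c).
  by apply: (exchange_step gE _ _ piv) => //; rewrite eq_sym.
rewrite -step1; apply: (exchange_step (a := a) (a' := a') gE) => //.
by rewrite !step1.
Qed.

Lemma upd_invariant_const (I : finType) (A T : Type) (h : {ffun I -> A} -> T) :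
  (forall i v a, h (upd v i a) = h v) -> forall v w, h v = h w.
Proof.
move=> hI v w.
suff /(_ (enum I)) hs : forall s : seq I,
    h [ffun k => if k \in s then w k else v k] = h v.
  by rewrite -hs; congr h; apply/ffunP => k; rewrite ffunE mem_enum.
elim=> [|i s IHs]; first by congr h; apply/ffunP => k; rewrite ffunE.
rewrite -IHs -[RHS](hI i _ (w i)); congr h; apply/ffunP => k; rewrite !ffunE inE.
by case: eqP => [->|].
Qed.

(** Multiplicities are dropped: for a coset of a fixing subgroup this set is the block holding the
    rank of [j], and these blocks determine the coset. *)
Definition rankset (m : nat) (K : {set 'S_m}) (j : 'I_m) : {set 'I_m} :=
  [set r in jprofile K j].

Lemma rankset_rcoset m (H : {group 'S_m}) (z : 'S_m) j :
  rankset (H :* z) j = orbit 'P H (z^-1 j).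
Proof.
apply/setP => r; rewrite inE; apply/imageP/orbitP => [[u /rcosetP[h Hh ->] ->]|].
  by exists h^-1; rewrite ?groupV //= /aperm invMg permM.
case=> h Hh <-; exists (h^-1 * z); first by rewrite mem_rcoset mulgK groupV.
by rewrite invMg invgK permM.
Qed.

(** An orbit of [H] stays inside a block, so [u] maps each block into itself, and onto itself by
    cardinality. *)
Lemma fixing_orbit m (H : {group 'S_m}) (u : 'S_m) :
  fixing H -> (forall r, u r \in orbit 'P H r) -> u \in H.
Proof.
case=> P [_ _ defH] uO; rewrite defH inE; apply/forall_inP => B PB.
rewrite eqEcard card_imset ?leqnn ?andbT; last exact: perm_inj.
apply/subsetP => _ /imsetP[r Br ->]; have /orbitP[h Hh <-] := uO r.
move: Hh; rewrite defH inE => /forall_inP/(_ B PB)/eqP hB.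
have := imset_f h Br; rewrite hB; apply.
Qed.

Lemma rankset_inj m (H : {group 'S_m}) (y z : 'S_m) :
  fixing H -> (forall j, rankset (H :* y) j = rankset (H :* z) j) ->
  H :* y = H :* z.
Proof.
move=> Hfix yz; apply: rcoset_eqP; rewrite mem_rcoset.
apply: (fixing_orbit Hfix) => r; rewrite permM.
by have := yz (y r); rewrite !rankset_rcoset permK => ->; exact: orbit_refl.
Qed.

(** The right side is free of [z]: the number of alternatives receiving a given block is the same
    for all cosets. *)
Lemma card_rankset m (H : {group 'S_m}) (z : 'S_m) (O : {set 'I_m}) :
  \sum_(j : 'I_m) (rankset (H :* z) j == O) =
  \sum_(r : 'I_m) (orbit 'P H r == O).
Proof.
rewrite (reindex_inj (@perm_inj _ z)) /=; apply: eq_bigr => r _.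
by rewrite rankset_rcoset permK.
Qed.

Lemma ex_perm2 (T : finType) (j j' a b : T) :
  j != j' -> a != b -> exists s : {perm T}, (s j == a) && (s j' == b).
Proof.
(* The first transposition sends [j] to [a]; the second brings the image of [j'] to [b] and fixes
   [a]. *)
move=> jj' ab; exists (tperm j a * tperm (tperm j a j') b).
rewrite !permM tpermL [X in _ && (X == _)]tpermL eqxx andbT tpermD 1?eq_sym //.
by rewrite -[X in X != _](tpermL j a) (inj_eq perm_inj).
Qed.

Definition ranks n m (x : profile n m) (j : 'I_m) : {ffun 'I_n -> 'I_m} :=
  [ffun i => (x i)^-1 j].

(** IR is applied to one voter at a time, passing from [x] to [y] along [enum 'I_n]. *)
Lemma IR_ranks n m (f : profile n m -> {set 'S_m}) (x y : profile n m) j :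
  IR f -> ranks x j = ranks y j -> rankset (f x) j = rankset (f y) j.
Proof.
move=> fIR /ffunP xy.
suff /(_ (enum 'I_n)) fs : forall s : seq 'I_n,
    rankset (f [ffun k => if k \in s then y k else x k]) j = rankset (f x) j.
  rewrite -fs; congr (rankset (f _) j).
  by apply/ffunP => k; rewrite ffunE mem_enum.
elim=> [|i s IHs].
  by congr (rankset (f _) j); apply/ffunP => k; rewrite ffunE.
rewrite -IHs; set t := [ffun k => if k \in s then _ else _].
have -> : [ffun k => if k \in i :: s then y k else x k] = replace t i (y i).
  by apply/ffunP => k; rewrite !ffunE inE; case: eqP => [->|].
have ti : (t i)^-1 j = (y i)^-1 j.
  by rewrite ffunE; case: ifP => // _; have := xy i; rewrite !ffunE.
by apply/setP => r; rewrite !inE -(perm_mem (fIR i j t (y i) ti)).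
Qed.

(** [tperm j (v i)] is just one ranking that puts [j] at rank [v i]; under IR the choice is
    immaterial. *)
Definition winset n m (f : profile n m -> {set 'S_m}) (j : 'I_m)
    (v : {ffun 'I_n -> 'I_m}) : {set 'I_m} :=
  rankset (f [ffun i => tperm j (v i)]) j.

Lemma winsetE n m (f : profile n m -> {set 'S_m}) (x : profile n m) j :
  IR f -> rankset (f x) j = winset f j (ranks x j).
Proof.
move=> fIR; apply: IR_ranks => //; apply/ffunP => i.
by rewrite !ffunE tpermV tpermL.
Qed.

Lemma winset_exchange n m (H : {group 'S_m}) (f : profile n m -> {set 'S_m}) :
  social_aggregator H f -> IR f -> exchange (winset f).
Proof.
move=> fH fIR i j j' v w jj' vw piv.
pose r k := xchoose (ex_perm2 jj' (vw k)).
have rj k : r k j = v k by have /andP[/eqP] := xchooseP (ex_perm2 jj' (vw k)).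
have rj' k : r k j' = w k.
  by have /andP[_ /eqP] := xchooseP (ex_perm2 jj' (vw k)).
pose x : profile n m := [ffun k => (r k)^-1].
pose x' := replace x i ((r i)^-1 * tperm j j').
have xj : ranks x j = v by apply/ffunP => k; rewrite !ffunE invgK.
have xj' : ranks x j' = w by apply/ffunP => k; rewrite !ffunE invgK.
have x'E l k : ranks x' l k = if k == i then r i (tperm j j' l) else r k l.
  by rewrite !ffunE; case: eqP => _; rewrite ?ffunE ?invMg ?invgK ?tpermV ?permM.
have x'j : ranks x' j = upd v i (w i).
  by apply/ffunP => k; rewrite x'E tpermL rj' rj ffunE.
have x'j' : ranks x' j' = upd w i (v i).
  by apply/ffunP => k; rewrite x'E tpermR rj' rj ffunE.
have x'l l : l != j -> l != j' -> ranks x' l = ranks x l.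
  move=> lj lj'; apply/ffunP => k; rewrite x'E !ffunE invgK.
  by rewrite tpermD 1?eq_sym //; case: eqP => // ->.
have cnt : \sum_l (winset f l (ranks x l) == winset f j v) =
           \sum_l (winset f l (ranks x' l) == winset f j v).
  have sumE y : \sum_l (winset f l (ranks y l) == winset f j v) =
      \sum_l (orbit 'P H l == winset f j v).
    have /rcosetsP[z _ fy] := fH y.
    by rewrite -(card_rankset H z) -fy; apply: eq_bigr => l _; rewrite winsetE.
  by rewrite !sumE.
move: cnt; rewrite (bigD1 j) // [RHS](bigD1 j) //=.
rewrite (bigD1 j') 1?eq_sym // [X in _ = _ + X](bigD1 j') 1?eq_sym //=.
rewrite [X in _ = _ + (_ + X)](eq_bigr
  (fun l => (winset f l (ranks x l) == winset f j v) : nat)); last first.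
  by move=> l /andP[lj lj']; rewrite x'l.
rewrite xj xj' x'j x'j' eqxx [winset f j (upd _ _ _) == _]eq_sym (negbTE piv).
(* With the other alternatives cancelled, [j] counts 1 before the swap and 0 after it, so [j'] must
   count 1 after it. *)
rewrite !addnA => /addIn.
by case: eqP => _; case: eqP.
Qed.

Theorem theorem3p9 (m n : nat) (hm : 3 <= m) (hn : 1 <= n)
    (H : {group 'S_m}) (hH : fixing H)
    (f : profile n m -> {set 'S_m}) (hf : social_aggregator H f)
    (hIR : IR f) :
  (exists K : {set 'S_m}, forall x : profile n m, f x = K) \/
  (exists (i : 'I_n) (y : 'S_m),
     forall x : profile n m, f x = [set h * y * x i | h in H]).
Proof.
have gE := winset_exchange hf hIR.
have I3 : 3 <= #|'I_m| by rewrite card_ord.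
(* In the identity profile alternative [r] has rank [r] for all voters, so [f x0] shows which block
   goes to the dictator's choice of rank [r]. *)
pose x0 : profile n m := [ffun=> 1].
have /rcosetsP[y _ fx0] := hf x0.
case: (boolP [exists i, exists j, exists v, exists a,
    winset f j (upd v i (v i)) != winset f j (upd v i a)]) => [|nopiv].
  case/existsP=> i /existsP[j /existsP[v /existsP[a piv]]]; right; exists i, y.
  have dict := exchange_dictator I3 I3 gE piv.
  move=> x; have -> : [set h * y * x i | h in H] = H :* (y * x i).
    apply/setP => u; apply/imsetP/rcosetP => -[h Hh ->];
      by exists h; rewrite ?mulgA.
  have /rcosetsP[z _ fx] := hf x.
  rewrite fx; apply: (rankset_inj hH) => l.
  rewrite -fx rankset_rcoset invMg permM -(rankset_rcoset H) -fx0 !winsetE //.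
  (* Both sides reduce to [winset f j] at [v] with [i]-th coordinate [(x i)^-1 l]. *)
  rewrite -(upd_id (ranks x l) i) -(upd_id (ranks x0 _) i) !dict !ffunE.
  by rewrite invg1 perm1.
left; exists (f x0) => x; have /rcosetsP[z _ fx] := hf x.
rewrite fx fx0; apply: (rankset_inj hH) => j.
rewrite -fx -fx0 !winsetE //; apply: upd_invariant_const => i v a.
move: nopiv; rewrite negb_exists => /forallP/(_ i).
rewrite negb_exists => /forallP/(_ j); rewrite negb_exists => /forallP/(_ v).
by rewrite negb_exists => /forallP/(_ a); rewrite negbK upd_id => /eqP.
Qed.
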